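(* With probability one there exists $n_0$ such that for every $n\ge n_0$ the function $\mathbb R^3\ni(\alpha',\theta_1',\theta_2')\mapsto Q_n(\mathbf Y_n;\alpha',\theta_1',\theta_2')$ has a unique global minimizer $(\tilde\alpha_n,\tilde\theta_{1,n},\tilde\theta_{2,n})$, given by $$\tilde\alpha_n=\frac{\sum_{k=1,k\notin\{s_1,s_2\}}^n(Y_k-\mu_\varepsilon)Y_{k-1}}{\sum_{k=1,k\notin\{s_1,s_2\}}^nY_{k-1}^2},\qquad \tilde\theta_{i,n}=Y_{s_i}-\tilde\alpha_nY_{s_i-1}-\mu_\varepsilon\ (i=1,2).$$ Moreover, for every $(\alpha,\theta_1,\theta_2)\in(0,1)\times\mathbb N^2$, almost surely $\tilde\alpha_n\to\alpha$ and $\tilde\theta_{i,n}\to Y_{s_i}-\alpha Y_{s_i-1}-\mu_\varepsilon$ for $i=1,2$.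
   Context: INAR(1) with two innovational outliers: Let $\alpha\in(0,1)$. Let $(\varepsilon_k)_{k\in\mathbb N}$ be i.i.d. non-negative integer-valued random variables with $\mathbb E\varepsilon_1^2<\infty$ and $\mathbb P(\varepsilon_1\ne 0)>0$; write $\mu_\varepsilon=\mathbb E\varepsilon_1$ (assumed known). For each $k\in\mathbb N$ let $(\xi_{k,j})_{j\in\mathbb N}$ be i.i.d. Bernoulli random variables with mean $\alpha$, these sequences being mutually independent and independent of $(\varepsilon_k)$. Fix known times $s_1\neq s_2$ in $\mathbb N$ and sizes $\theta_1,\theta_2\in\mathbb N$. Let $Y_0$ be a non-negative integer-valued random variable with $\mathbb E Y_0^2<\infty$, independent of all $\xi_{k,j},\varepsilon_k$, and $Y_k=\sum_{j=1}^{Y_{k-1}}\xi_{k,j}+\varepsilon_k+\delta_{k,s_1}\theta_1+\delta_{k,s_2}\theta_2$, $k\in\mathbb N$. Write $\mathbf Y_n=(Y_0,\dots,Y_n)$. For $n\ge\max(s_1,s_2)$, $$Q_n(\mathbf y_n;\alpha',\theta_1',\theta_2')=\sum_{\substack{k=1\\k\notin\{s_1,s_2\}}}^n(y_k-\alpha'y_{k-1}-\mu_\varepsilon)^2+\sum_{i=1}^2(y_{s_i}-\alpha'y_{s_i-1}-\mu_\varepsilon-\theta_i')^2 .$$ *)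

(* Defs.v *)
From HB Require Import structures.
From mathcomp Require Import all_boot all_order all_algebra.
From mathcomp Require Import all_classical all_reals all_analysis.
Set Implicit Arguments. Unset Strict Implicit. Unset Printing Implicit Defensive.
Import Order.TTheory GRing.Theory Num.Theory.
Local Open Scope classical_set_scope.
Local Open Scope ring_scope.

(* Indices of the primitive random variables of the INAR(1) model:
   Y_0, eps_k, xi_{k,j}. *)
Inductive inar_idx := IY0 | Ieps of nat | Ixi of nat & nat.

(* Only eps_k (k >= 1) and xi_{k,j} (k, j >= 1) enter the model. *)
Definition inar_valid (i : inar_idx) : Prop :=
  match i with
  | IY0 => True
  | Ieps k => (0 < k)%N
  | Ixi k j => (0 < k)%N /\ (0 < j)%N
  end.

Definition mutually_independent {d} {T : measurableType d} {R : realType}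
  (P : probability T R) {I : Type} (D : I -> Prop) (X : I -> T -> nat) : Prop :=
  forall (n : nat) (f : 'I_n -> I), injective f -> (forall i, D (f i)) ->
  forall A : 'I_n -> set nat,
    P (\bigcap_(i in [set: 'I_n]) (X (f i) @^-1` A i))
    = (\prod_(i < n) P (X (f i) @^-1` A i))%E.

Fixpoint inar_Y (xi : nat -> nat -> nat) (eps : nat -> nat) (y0 : nat)
  (s1 s2 th1 th2 : nat) (k : nat) : nat :=
  match k with
  | 0 => y0
  | k'.+1 => (\sum_(1 <= j < (inar_Y xi eps y0 s1 s2 th1 th2 k').+1) xi k'.+1 j
             + eps k'.+1 + (k'.+1 == s1) * th1 + (k'.+1 == s2) * th2)%N
  end.

Definition Qn {R : realType} (mu : R) (s1 s2 : nat) (y : nat -> R) (n : nat)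
  (a t1 t2 : R) : R :=
  \sum_(1 <= k < n.+1 | (k != s1) && (k != s2)) (y k - a * y k.-1 - mu) ^+ 2
  + (y s1 - a * y s1.-1 - mu - t1) ^+ 2
  + (y s2 - a * y s2.-1 - mu - t2) ^+ 2.

Definition alpha_tilde {R : realType} (mu : R) (s1 s2 : nat) (y : nat -> R)
  (n : nat) : R :=
  (\sum_(1 <= k < n.+1 | (k != s1) && (k != s2)) (y k - mu) * y k.-1)
  / (\sum_(1 <= k < n.+1 | (k != s1) && (k != s2)) y k.-1 ^+ 2).

Definition theta_tilde {R : realType} (mu : R) (s1 s2 : nat) (y : nat -> R)
  (n : nat) (s : nat) : R :=
  y s - alpha_tilde mu s1 s2 y n * y s.-1 - mu.

(* Main.v *)
Require Import Defs.
From HB Require Import structures.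
From mathcomp Require Import all_boot all_order all_algebra ring lra.
From mathcomp Require Import all_classical all_reals all_analysis.
From mathcomp Require Import measurable_realfun.
Import Order.TTheory GRing.Theory Num.Theory.
Import numFieldNormedType.Exports.
Local Open Scope classical_set_scope.
Local Open Scope ring_scope.

(* Write D_n for the sum of the Y_{k-1}^2 and S_n for the sum of the
   M_k Y_{k-1}, over k <= n outside {s1, s2}, where
   M_k = Y_k - alpha Y_{k-1} - mu is a martingale difference there. The
   criterion Q_n is a quadratic with minimizer alpha_tilde, and
   alpha_tilde - alpha = S_n / D_n. The weights D_n are predictable and
   self-normalizing: since Y_{k-1} <= (1 + D_k)^(1/2), the conditional variance
   of M_k Y_{k-1} is at most C (D_k - D_{k-1}) (1 + D_k)^(1/2). Hence, with
   r_n = (1 + D_n)^(1/4), the process S_n^2 / r_n^7 + 4 C / r_n is a nonnegative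
   supermartingale, without any moment assumption on Y. By the maximal
   inequality it is almost surely bounded, so (S_n / D_n)^2 = O(1 / r_n), and
   D_n diverges because eps_k <> 0 infinitely often. The maximal inequality is
   proved by backward induction over cylinder events, which prescribe the values
   of finitely many of the primitive variables. *)

(** * Pathwise algebra of the criterion and of the Lyapunov function *)

Section Regression.
Set Implicit Arguments. Unset Strict Implicit.
Context {R : realType}.
Variables (alpha mu : R) (s1 s2 : nat).
Implicit Types (y : nat -> R) (n : nat) (C lam : R).

Definition score y n : R :=
  \sum_(1 <= k < n.+1 | (k != s1) && (k != s2))
    (y k - alpha * y k.-1 - mu) * y k.-1.

Definition design y n : R :=
  \sum_(1 <= k < n.+1 | (k != s1) && (k != s2)) y k.-1 ^+ 2.

Definition root4 y n : R := Num.sqrt (Num.sqrt (1 + design y n)).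

Definition lyapunov C y n : R :=
  score y n ^+ 2 / root4 y n ^+ 7 + 4 * C / root4 y n.

Lemma big_nat_recr_cond (p : pred nat) (F : nat -> R) n :
  \sum_(1 <= k < n.+2 | p k) F k
  = \sum_(1 <= k < n.+1 | p k) F k + (if p n.+1 then F n.+1 else 0).
Proof. by rewrite big_mkcond big_nat_recr //= -big_mkcond. Qed.

Lemma design_ge0 y n : 0 <= design y n.
Proof. by apply: sumr_ge0 => k _; exact: sqr_ge0. Qed.

Lemma root4_ge1 y n : 1 <= root4 y n.
Proof.
have h : 1 <= 1 + design y n by rewrite lerDl design_ge0.
rewrite /root4 -[X in X <= _]sqrtr1 ler_sqrt ?sqrtr_ge0//.
by rewrite -[X in X <= _]sqrtr1 ler_sqrt // (le_trans ler01 h).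
Qed.

Lemma root4_gt0 y n : 0 < root4 y n.
Proof. exact: lt_le_trans ltr01 (root4_ge1 y n). Qed.

Lemma root4_sqr2 y n : (root4 y n ^+ 2) ^+ 2 = 1 + design y n.
Proof. by rewrite /root4 !sqr_sqrtr ?sqrtr_ge0 // addr_ge0 // design_ge0. Qed.

Lemma root4X4 y n : root4 y n ^+ 4 = 1 + design y n.
Proof. by rewrite -root4_sqr2 -exprM. Qed.

Lemma designS y n : design y n.+1
  = design y n + (if (n.+1 != s1) && (n.+1 != s2) then y n else 0) ^+ 2.
Proof.
by rewrite /design big_nat_recr_cond; case: ifP => // _; rewrite expr0n.
Qed.

Lemma scoreS y n : score y n.+1
  = score y n + (if (n.+1 != s1) && (n.+1 != s2) then y n else 0)
                * (y n.+1 - alpha * y n - mu).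
Proof.
by rewrite /score big_nat_recr_cond; case: ifP => // _; rewrite ?mul0r // mulrC.
Qed.

Lemma score_eq y y' n : (forall k, (k <= n)%N -> y k = y' k) ->
  score y n = score y' n.
Proof.
move=> e; rewrite /score big_nat_cond [RHS]big_nat_cond.
apply: eq_bigr => k /andP[/andP[k1 kn] _].
by rewrite !e // (leq_trans (leq_pred k)).
Qed.

(** The strict bound is predictability: [root4 y n] is already fixed when [y n] is drawn. *)
Lemma design_eq y y' n : (forall k, (k < n)%N -> y k = y' k) ->
  design y n = design y' n.
Proof.
move=> e; rewrite /design big_nat_cond [RHS]big_nat_cond.
apply: eq_bigr => k /andP[/andP[k1 kn] _].
by rewrite !e //; case: k k1 kn.
Qed.

Lemma lyapunov_eq C y y' n : (forall k, (k <= n)%N -> y k = y' k) ->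
  lyapunov C y n = lyapunov C y' n.
Proof.
move=> e; rewrite /lyapunov /root4 (score_eq e) (@design_eq y y') //.
by move=> k kn; apply: e; exact: ltnW.
Qed.

Lemma lyapunov0 C y : lyapunov C y 0 = 4 * C.
Proof.
rewrite /lyapunov /root4 /score /design !big_geq // addr0 !sqrtr1.
by rewrite expr0n /= mul0r add0r divr1.
Qed.

Lemma lyapunov_ge0 C y n : 0 <= C -> 0 <= lyapunov C y n.
Proof.
move=> C0; have q0 := ltW (root4_gt0 y n).
by rewrite addr_ge0 // divr_ge0 ?sqr_ge0 ?exprn_ge0 // mulr_ge0.
Qed.

(* [x / q^7 <= C (q^4 - p^4) / q^5 <= 4 C (1/p - 1/q)]: the variance of the
   increment is paid by the decrease of [4 C / q]. *)
Lemma lyapunov_budget (p q s x a C : R) : 1 <= p -> 0 < q -> 0 <= C ->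
  q ^+ 4 = p ^+ 4 + a ^+ 2 -> x <= C * a ^+ 2 * q ^+ 2 ->
  (s ^+ 2 + x) / q ^+ 7 + 4 * C / q <= s ^+ 2 / p ^+ 7 + 4 * C / p.
Proof.
move=> p1 q0 C0 qp xC.
have p0 : 0 < p by lra.
have pq : p <= q.
  rewrite -(@ler_pXn2r _ 4) ?nnegrE ?(ltW p0) ?(ltW q0) // qp lerDl.
  exact: sqr_ge0.
have h1 : s ^+ 2 / q ^+ 7 <= s ^+ 2 / p ^+ 7.
  rewrite ler_wpM2l ?sqr_ge0 // lef_pV2 ?posrE ?exprn_gt0 //.
  by rewrite ler_pXn2r ?nnegrE ?(ltW p0) ?(ltW q0).
suff h2 : x / q ^+ 7 <= 4 * C / p - 4 * C / q by rewrite mulrDl; lra.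
have -> : 4 * C / p - 4 * C / q = 4 * C * (q - p) / (p * q).
  by field; rewrite !gt_eqF.
rewrite ler_pdivrMr ?exprn_gt0 // mulrAC ler_pdivlMr ?mulr_gt0 //.
(* Since [p <= q], the cofactor of [q - p] is at most [4 * q ^+ 3]; this is the origin of the 4 in
   [4 * C]. *)
have a2 : a ^+ 2 = (q - p) * ((q + p) * (q ^+ 2 + p ^+ 2)) by
  rewrite -[LHS](addKr (p ^+ 4)) -qp; ring.
have h3 : (q + p) * (q ^+ 2 + p ^+ 2) <= 4 * q ^+ 3.
  have -> : 4 * q ^+ 3 = (q + q) * (q ^+ 2 + q ^+ 2) by ring.
  apply: ler_pM; rewrite ?addr_ge0 ?sqr_ge0 ?(ltW p0) ?(ltW q0) ?lerD //.
  by rewrite ler_pXn2r ?nnegrE ?(ltW p0) ?(ltW q0).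
have h4 : x <= C * ((q - p) * (4 * q ^+ 3)) * q ^+ 2.
  apply: (le_trans xC); rewrite ler_wpM2r ?sqr_ge0 // ler_wpM2l // a2.
  by rewrite ler_wpM2l // subr_ge0.
apply: (@le_trans _ _ (C * ((q - p) * (4 * q ^+ 3)) * q ^+ 2 * (p * q))).
  by rewrite ler_wpM2r // mulr_ge0 ?(ltW p0) ?(ltW q0).
have -> : C * ((q - p) * (4 * q ^+ 3)) * q ^+ 2 * (p * q)
   = 4 * C * (q - p) * q ^+ 6 * p by ring.
have -> : 4 * C * (q - p) * q ^+ 7 = 4 * C * (q - p) * q ^+ 6 * q by ring.
rewrite ler_wpM2l // !mulr_ge0 ?exprn_ge0 ?(ltW q0) //.
by rewrite subr_ge0.
Qed.

Lemma alpha_tildeE y n : design y n != 0 ->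
  alpha_tilde mu s1 s2 y n - alpha = score y n / design y n.
Proof.
move=> d0; rewrite /alpha_tilde -/(design y n).
rewrite -[X in _ - X](mulfK d0) -mulrBl; congr (_ / _).
rewrite /score /design mulr_sumr -sumrB; apply: eq_bigr => k _; ring.
Qed.

(** Completing the square: the normal equation [bd] removes the cross term, and the residuals at
    [s1] and [s2] vanish at the minimizer. *)
Lemma Qn_alpha_tilde y n (a t1 t2 : R) : design y n != 0 ->
  Qn mu s1 s2 y n a t1 t2
  = Qn mu s1 s2 y n (alpha_tilde mu s1 s2 y n)
       (theta_tilde mu s1 s2 y n s1) (theta_tilde mu s1 s2 y n s2)
    + (design y n * (a - alpha_tilde mu s1 s2 y n) ^+ 2
       + (y s1 - a * y s1.-1 - mu - t1) ^+ 2
       + (y s2 - a * y s2.-1 - mu - t2) ^+ 2).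
Proof.
move=> d0; rewrite /Qn /theta_tilde.
set b := alpha_tilde mu s1 s2 y n.
have bd : b * design y n =
    \sum_(1 <= k < n.+1 | (k != s1) && (k != s2)) (y k - mu) * y k.-1.
  by rewrite /b /alpha_tilde divfK.
have -> : \sum_(1 <= k < n.+1 | (k != s1) && (k != s2))
      (y k - a * y k.-1 - mu) ^+ 2 =
   \sum_(1 <= k < n.+1 | (k != s1) && (k != s2)) (y k - b * y k.-1 - mu) ^+ 2
   + design y n * (a - b) ^+ 2.
  transitivity (\sum_(1 <= k < n.+1 | (k != s1) && (k != s2))
      (y k - b * y k.-1 - mu) ^+ 2
    + (2 * (b - a) * (\sum_(1 <= k < n.+1 | (k != s1) && (k != s2))
        (y k - mu) * y k.-1) + (a ^+ 2 - b ^+ 2) * design y n)).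
    rewrite /design !mulr_sumr -!big_split /=; apply: eq_bigr => k _; ring.
  by rewrite -bd; ring.
have e (s : nat) : y s - b * y s.-1 - mu - (y s - b * y s.-1 - mu) = 0 by ring.
rewrite !e expr0n /=; ring.
Qed.

Lemma Qn_unique_min y n (a t1 t2 : R) : 0 < design y n ->
  (a, t1, t2) <> (alpha_tilde mu s1 s2 y n, theta_tilde mu s1 s2 y n s1,
                  theta_tilde mu s1 s2 y n s2) ->
  Qn mu s1 s2 y n (alpha_tilde mu s1 s2 y n)
     (theta_tilde mu s1 s2 y n s1) (theta_tilde mu s1 s2 y n s2)
  < Qn mu s1 s2 y n a t1 t2.
Proof.
move=> d0 neq; rewrite [ltRHS](Qn_alpha_tilde a) ?gt_eqF // ltrDl.
have q0 : 0 <= design y n * (a - alpha_tilde mu s1 s2 y n) ^+ 2.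
  by rewrite mulr_ge0 ?sqr_ge0 ?ltW.
rewrite lt0r !addr_ge0 ?sqr_ge0 // andbT.
rewrite !paddr_eq0 ?addr_ge0 ?sqr_ge0 //.
rewrite mulf_eq0 (gt_eqF d0) /= !sqrf_eq0 !subr_eq0.
apply/negP => /andP[/andP[/eqP ea /eqP e1] /eqP e2]; apply: neq.
by rewrite -e1 -e2 /theta_tilde -ea.
Qed.

Lemma design_homo y : {homo design y : m n / (m <= n)%N >-> m <= n}.
Proof.
apply: homo_leq => [//|x z t|n]; first exact: le_trans.
by rewrite designS lerDl sqr_ge0.
Qed.

Lemma design_unbounded y : (forall m, exists2 k, (m <= k)%N & 1 <= y k) ->
  forall M : R, exists n0, forall n, (n0 <= n)%N -> M <= design y n.
Proof.
move=> yio.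
have step m : exists n, m%:R <= design y n.
  elim: m => [|m [n mn]]; first by exists 0%N; rewrite design_ge0.
  (* Going beyond [s1] and [s2] makes [k.+1] a regular time, so [y k] adds at least 1 to the
     design. *)
  have [k nk yk] := yio (maxn n (maxn s1 s2)).
  exists k.+1; rewrite designS.
  have -> : (k.+1 != s1) && (k.+1 != s2).
    move: nk; rewrite !geq_max => /and3P[_ k1 k2].
    by rewrite !gtn_eqF.
  rewrite -natr1 lerD //; last by rewrite expr_ge1 // (le_trans ler01).
  by rewrite (le_trans mn) // design_homo // (leq_trans _ nk) // leq_maxl.
move=> M; have [n hn] := step (Num.trunc M).+1.
exists n => k nk; rewrite (le_trans _ (design_homo y nk)) // (le_trans _ hn) //.
by rewrite ltW // truncnS_gt.
Qed.

(* On the event [lyapunov < lam] the squared estimation error is at most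
   [lam * r^7 / design^2], of order [lam / r]. *)
Lemma alpha_tilde_cvg C lam y : 0 <= C ->
  (forall M : R, exists n0, forall n, (n0 <= n)%N -> M <= design y n) ->
  (forall n, lyapunov C y n < lam) ->
  alpha_tilde mu s1 s2 y n @[n --> \oo] --> alpha.
Proof.
move=> C0 dinf Vlam; apply/cvgrPdist_le => e e0.
(* With [r] for [root4 y n], [M <= r] gives [lam * r ^+ 7 <= e ^+ 2 * r ^+ 8 / 4]. *)
pose M := 4 * lam / e ^+ 2.
(* This bound serves twice: it yields [M <= root4 y n], and a design of at least 1, whence
   [root4 y n ^+ 8 <= 4 * design y n ^+ 2]. *)
have [n0 hn0] := dinf (1 + M ^+ 4).
near=> n.
have dn : 1 + M ^+ 4 <= design y n by apply: hn0; near: n; exact: nbhs_infty_ge.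
have M4 : 0 <= M ^+ 4 by rewrite (_ : 4 = 2 * 2)%N // exprM sqr_ge0.
have d0 : 0 < design y n by lra.
rewrite distrC alpha_tildeE ?gt_eqF // normrM normfV (gtr0_norm d0).
rewrite ler_pdivrMr //.
have r0 := root4_gt0 y n; have r4 := root4X4 y n.
have lam0 : 0 <= lam by apply: le_trans (lyapunov_ge0 y 0 C0) (ltW (Vlam 0%N)).
have M0 : 0 <= M by rewrite divr_ge0 ?sqr_ge0 ?mulr_ge0.
have Mr : M <= root4 y n.
  rewrite -(@ler_pXn2r _ 4) ?nnegrE ?(ltW r0) // r4; lra.
have s2lam : score y n ^+ 2 <= lam * root4 y n ^+ 7.
  rewrite -ler_pdivrMr ?exprn_gt0 //; apply: le_trans (ltW (Vlam n)).
  by rewrite /lyapunov lerDl divr_ge0 ?mulr_ge0 ?(ltW r0).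
rewrite -(@ler_pXn2r _ 2) ?nnegrE ?normr_ge0 ?mulr_ge0 ?(ltW e0) ?(ltW d0) //.
rewrite real_normK ?num_real // (le_trans s2lam) //.
have lame : 4 * lam <= e ^+ 2 * root4 y n.
  by rewrite [leRHS]mulrC -ler_pdivrMr ?exprn_gt0.
have h8 : 4 * (lam * root4 y n ^+ 7) <= e ^+ 2 * root4 y n ^+ 8.
  have -> : 4 * (lam * root4 y n ^+ 7) = 4 * lam * root4 y n ^+ 7 by ring.
  have -> : e ^+ 2 * root4 y n ^+ 8 = e ^+ 2 * root4 y n * root4 y n ^+ 7 by ring.
  by rewrite ler_wpM2r // exprn_ge0 // ltW.
have r8 : root4 y n ^+ 8 <= 4 * design y n ^+ 2.
  have -> : root4 y n ^+ 8 = (root4 y n ^+ 4) ^+ 2 by ring.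
  rewrite r4; nra.
have : e ^+ 2 * root4 y n ^+ 8 <= e ^+ 2 * (4 * design y n ^+ 2).
  by rewrite ler_wpM2l ?sqr_ge0.
rewrite exprMn; lra.
Unshelve. all: by end_near. Qed.

End Regression.

(** * Discrete random variables through their fibers *)

Section CountableFibers.
Set Implicit Arguments. Unset Strict Implicit.
Context d (T : measurableType d).

(** Stated on fibers to cover maps into any countable type, such as finite sequences of values,
    without choosing a sigma-algebra on it. *)
Definition measurable_fibers (C : Type) (f : T -> C) :=
  forall c, measurable (f @^-1` [set c]).

Lemma measurable_fibers_preimage (C : countType) (f : T -> C) (B : set C) :
  measurable_fibers f -> measurable (f @^-1` B).
Proof.
move=> mf; have -> : f @^-1` B = \bigcup_c (f @^-1` ([set c] `&` B)).
  rewrite predeqE => w; split => [Bw|[c _ []]//]; by exists (f w).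
apply: countable_bigcupT_measurable => // c.
have [Bc|nBc] := pselect (B c).
  by rewrite (_ : [set c] `&` B = [set c])//; apply/setIidPl => _ ->.
rewrite (_ : _ `&` _ = set0) ?preimage_set0 //.
by rewrite -subset0 => x [-> ].
Qed.

(** Splitting over the values of [f] reduces a random choice of [g] to fixed ones; the thinning sum,
    of random length, has this form. *)
Lemma measurable_fibers_bind (C D : countType) (f : T -> C) (g : C -> T -> D) :
  measurable_fibers f -> (forall c, measurable_fibers (g c)) ->
  measurable_fibers (fun w => g (f w) w).
Proof.
move=> mf mg e.
rewrite (_ : _ @^-1` _ = \bigcup_c (f @^-1` [set c] `&` g c @^-1` [set e])).
  apply: countable_bigcupT_measurable => // c.
  by apply: measurableI; [exact: mf|exact: mg].
rewrite predeqE => w; split => [ge|[c _ [/= <-]]//].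
by exists (f w).
Qed.

Lemma measurable_fibers_comp (C D : countType) (f : T -> C) (h : C -> D) :
  measurable_fibers f -> measurable_fibers (h \o f).
Proof.
by move=> mf e; rewrite comp_preimage; exact: measurable_fibers_preimage.
Qed.

Lemma measurable_fibers2 (A B C : countType) (h : A -> B -> C) f g :
  measurable_fibers f -> measurable_fibers g ->
  measurable_fibers (fun w : T => h (f w) (g w)).
Proof.
move=> mf mg; apply: (measurable_fibers_bind (g := fun a w => h a (g w))) => // a.
exact: measurable_fibers_comp mg.
Qed.

Lemma measurable_fibers_sum (F : nat -> T -> nat) m n :
  (forall i, measurable_fibers (F i)) ->
  measurable_fibers (fun w => \sum_(m <= i < n) F i w)%N.
Proof.
move=> mF; elim: n => [|n ih].
  move=> c; rewrite (_ : (fun w => _) = cst 0%N) ?preimage_cst; first by case: ifP.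
  by apply: funext => w; rewrite big_geq.
have [mn|nm] := leqP m n; last first.
  move=> c; rewrite (_ : (fun w => _) = cst 0%N) ?preimage_cst; first by case: ifP.
  by apply: funext => w; rewrite big_geq.
rewrite (_ : (fun w => _) = fun w => (\sum_(m <= i < n) F i w + F n w)%N).
  exact: measurable_fibers2.
by apply: funext => w; rewrite big_nat_recr.
Qed.

Context (R : realType) (P : probability T R).

Lemma measure_fibers (Z : T -> nat) (A : set T) :
  measurable_fibers Z -> measurable A ->
  P A = (\sum_(0 <= e <oo) P (A `&` Z @^-1` [set e]))%E.
Proof.
move=> mZ mA.
rewrite [in LHS](_ : A = \bigcup_e (A `&` Z @^-1` [set e])).
  rewrite measure_bigcup.
  - by apply: eq_eseriesl => e; rewrite in_setT.
  - by move=> e _; apply: measurableI.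
  - by apply/trivIsetP => i j _ _ ij; rewrite -subset0 => w [[_ /= zi] [_ /= zj]];
      move: ij; rewrite -zi -zj eqxx.
rewrite predeqE => w; split => [Aw|[e _ []]//]; by exists (Z w).
Qed.

Lemma integral_fibers (Z : T -> nat) (g : nat -> R) :
  measurable_fibers Z -> (forall e, 0 <= g e) ->
  (\int[P]_w (g (Z w))%:E = \sum_(0 <= e <oo) (g e)%:E * P (Z @^-1` [set e]))%E.
Proof.
move=> mZ g0.
have mg : measurable_fun setT (EFin \o (g \o Z)).
  move=> _ B mB; rewrite setTI.
  by rewrite (_ : _ @^-1` _ = Z @^-1` [set e | B (g e)%:E]) //;
    exact: measurable_fibers_preimage.
have UT : setT = \bigcup_e (Z @^-1` [set e]).
  by rewrite predeqE => w; split => // _; exists (Z w).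
rewrite [in LHS]UT ge0_integral_bigcup.
- apply: eq_eseriesr => e _.
  rewrite -integral_cst //; apply: eq_integral => w.
  by rewrite inE /= => ->.
- exact: mZ.
- by rewrite -UT.
- by move=> w _; rewrite lee_fin.
- by apply/trivIsetP => i j _ _ ij; rewrite -subset0 => w [/= zi /= zj];
    move: ij; rewrite -zi -zj eqxx.
Qed.

End CountableFibers.

(** * Cylinder events of independent variables *)

Section Cylinders.
Set Implicit Arguments. Unset Strict Implicit.
Context d (T : measurableType d) (R : realType) (P : probability T R).
Context (I : eqType) (D : I -> Prop) (X : I -> T -> nat).
Hypothesis indep : mutually_independent P D X.
Hypothesis mX : forall i, measurable_fibers (X i).

(** An elementary substitute for conditioning on the past: the list [s] records the variables
    already prescribed, so [i \notin s] says that [X i] is still fresh. *)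
Definition cylinder (s : seq I) (B : set T) : Prop :=
  [/\ uniq s, forall i, i \in s -> D i &
      exists v : I -> nat, B = [set w | forall i, i \in s -> X i w = v i]].

Lemma cylinder_nil : cylinder [::] setT.
Proof. by split => //; exists (fun=> 0%N); rewrite predeqE. Qed.

Lemma cylinder_setI s v i c : i \notin s ->
  [set w | forall j, j \in s -> X j w = v j] `&` X i @^-1` [set c]
  = [set w | forall j, j \in i :: s -> X j w = if j == i then c else v j].
Proof.
move=> si; rewrite predeqE => w; split => [[/= sv ic] j|/= h].
  by rewrite inE; case: eqVneq => [->//|_ /= /sv].
split => [j js /=|]; last by have := h i; rewrite inE eqxx => ->.
have := h j; rewrite inE js orbT => ->//.
by case: eqVneq js si => [-> ->|].
Qed.

Lemma cylinder_cons s B i c : cylinder s B -> D i -> i \notin s ->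
  cylinder (i :: s) (B `&` X i @^-1` [set c]).
Proof.
move=> [us Ds [v ->]] Di si; split; first by rewrite /= si us.
  by move=> j; rewrite inE => /orP[/eqP->|/Ds].
by eexists; exact: cylinder_setI.
Qed.

Lemma measurable_cylinder s B : cylinder s B -> measurable B.
Proof.
case=> _ _ [v ->].
elim: s => [|i s ih].
  by rewrite (_ : [set _ | _] = setT) // predeqE.
rewrite (_ : [set _ | _] = X i @^-1` [set v i] `&`
  [set w | forall i, i \in s -> X i w = v i]); first by apply: measurableI => //; exact: mX.
rewrite predeqE => w; split => [h|[/= h1 h2] j].
  split => [|j js]; first by apply: h; rewrite inE eqxx.
  by apply: h; rewrite inE js orbT.
by rewrite inE => /orP[/eqP->//|/h2].
Qed.

Lemma probability_cylinder s (v : I -> nat) : uniq s ->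
  (forall i, i \in s -> D i) ->
  P [set w | forall i, i \in s -> X i w = v i]
  = (\prod_(i <- s) P (X i @^-1` [set v i]))%E.
Proof.
move=> us Ds.
(* Independence speaks of injective families over ordinals; a list without repetition is one through
   [tnth]. *)
have inj : injective (tnth (in_tuple s)) by apply/tuple_uniqP.
rewrite big_tnth -(indep inj _ (fun i => [set v (tnth (in_tuple s) i)])); last first.
  by move=> i; apply/Ds/mem_tnth.
congr (P _); rewrite predeqE => w; split => [h i _ /=|h i].
  by apply: h; exact: mem_tnth.
by move=> /(tnthP (in_tuple s))[j ->]; exact: h.
Qed.

(** Both sides are the same product of one-variable probabilities; this is how independence enters
    the one-step estimate. *)
Lemma probability_cylinder_cons s B i c : cylinder s B -> D i -> i \notin s ->
  P (B `&` X i @^-1` [set c]) = (P B * P (X i @^-1` [set c]))%E.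
Proof.
move=> [us Ds [v ->]] Di si; rewrite cylinder_setI // !probability_cylinder //.
- rewrite big_cons eqxx muleC; congr (_ * _)%E.
  rewrite big_seq [RHS]big_seq; apply: eq_bigr => j js.
  by case: eqVneq js si => [-> ->|].
- by rewrite /= si.
- by move=> j; rewrite inE => /orP[/eqP->|/Ds].
Qed.

End Cylinders.

HB.instance Definition _ := gen_eqMixin inar_idx.

(** The time at which a variable enters the recursion; [stage i <= k] on the list of a cylinder
    plays the part of measurability with respect to the past up to [k]. *)
Definition stage (i : inar_idx) : nat :=
  match i with IY0 => 0%N | Ieps k => k | Ixi k _ => k end.

Definition inar_var {T : Type} (eps : nat -> T -> nat)
  (xi : nat -> nat -> T -> nat) (Y0 : T -> nat) (i : inar_idx) : T -> nat :=
  match i with IY0 => Y0 | Ieps k => eps k | Ixi k j => xi k j end.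

(** * The INAR(1) path and the measurability of its crossing events *)

Section Model.
Set Implicit Arguments. Unset Strict Implicit.
Context d (T : measurableType d) (R : realType) (P : probability T R).
Variables (alpha mu K : R) (eps : nat -> T -> nat) (xi : nat -> nat -> T -> nat).
Variables (Y0 : T -> nat) (s1 s2 th1 th2 : nat).
Hypothesis alpha01 : 0 < alpha < 1.
Hypothesis meps : forall k, measurable_fibers (eps k).
Hypothesis mxi : forall k j, measurable_fibers (xi k j).
Hypothesis mY0 : measurable_fibers Y0.
Hypothesis indep : mutually_independent P inar_valid (inar_var eps xi Y0).
Hypothesis eps_id : forall k m, (0 < k)%N ->
  P (eps k @^-1` [set m]) = P (eps 1%N @^-1` [set m]).
Hypothesis eps_mean : (\int[P]_w ((eps 1%N w)%:R : R)%:E = mu%:E)%E.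
Hypothesis eps_sqr : (\int[P]_w (((eps 1%N w)%:R : R) ^+ 2)%:E = K%:E)%E.
Hypothesis xi_law : forall k j, (0 < k)%N -> (0 < j)%N ->
  P (xi k j @^-1` [set 1%N]) = alpha%:E /\
  P (xi k j @^-1` [set 0%N]) = (1 - alpha)%:E.

Let X := inar_var eps xi Y0.
Let path (w : T) : nat -> nat :=
  inar_Y (fun k j => xi k j w) (fun k => eps k w) (Y0 w) s1 s2 th1 th2.
(** The constant [1 + K] comes from the one-step variance after a value [x], namely
    [x * alpha * (1 - alpha) + K - mu ^+ 2], which is at most [x + K]. *)
Let V (y : nat -> nat) (n : nat) : R :=
  lyapunov alpha mu s1 s2 (1 + K) (fun i => (y i)%:R) n.

Let mX i : measurable_fibers (X i).
Proof. by case: i => [|k|k j]; rewrite /X /=. Qed.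

Let K_ge0 : 0 <= K.
Proof. by rewrite -lee_fin -eps_sqr; apply: integral_ge0 => w _; rewrite lee_fin sqr_ge0. Qed.

Let measurable_path n : measurable_fibers (fun w => path w n).
Proof.
elim: n => [|n ih]; first exact: mY0.
apply: (measurable_fibers_bind (g := fun y w =>
  (\sum_(1 <= j < y.+1) xi n.+1 j w + eps n.+1 w
   + (n.+1 == s1) * th1 + (n.+1 == s2) * th2)%N)) => // y.
apply: (measurable_fibers_comp
  (fun m => (m + (n.+1 == s1) * th1 + (n.+1 == s2) * th2)%N)).
apply: measurable_fibers2 => //.
exact: measurable_fibers_sum.
Qed.

Lemma measurable_prefix n : measurable_fibers (fun w => mkseq (path w) n).
Proof.
elim: n => [|n ih].
  by move=> c; rewrite /mkseq /= preimage_cst; case: ifP.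
rewrite (_ : (fun w => _) = fun w => rcons (mkseq (path w) n) (path w n)).
  exact: measurable_fibers2.
by apply: funext => w; rewrite mkseqS.
Qed.

(** The finite horizon [N] permits backward induction; its limit is taken only in
    [lyapunov_bounded_ae]. *)
Definition hit (lam : R) (k N : nat) : set T :=
  [set w | exists2 i, (i <= N)%N & lam <= V (path w) (k + i)].

Lemma measurable_hit lam k N : measurable (hit lam k N).
Proof.
(* [V] at time [n] reads the values up to [n], so a prefix of length [(k + N).+1] decides the
   event. *)
rewrite (_ : hit lam k N = (fun w => mkseq (path w) (k + N).+1) @^-1`
  [set l | exists2 i, (i <= N)%N & lam <= V (nth 0%N l) (k + i)]).
  exact: measurable_fibers_preimage (measurable_prefix _).
have e w i : (i <= N)%N ->
    V (nth 0%N (mkseq (path w) (k + N).+1)) (k + i) = V (path w) (k + i).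
  move=> iN; apply: lyapunov_eq => j ji.
  by rewrite nth_mkseq // ltnS (leq_trans ji) // leq_add2l.
by rewrite predeqE => w; split => -[i iN h]; exists i; rewrite // ?e // -e.
Qed.

(** * Averaging over one step of the recursion *)

Lemma integral_quadratic (q0 q1 q2 : R) :
  (\int[P]_w (q0 + q1 * (eps 1%N w)%:R + q2 * (eps 1%N w)%:R ^+ 2)%:E
  = (q0 + q1 * mu + q2 * K)%:E)%E.
Proof.
have mf (g : nat -> R) : measurable_fun [set: T] (EFin \o (g \o eps 1%N)).
  move=> _ B mB; rewrite setTI.
  by rewrite (_ : _ @^-1` _ = eps 1%N @^-1` [set e | B (g e)%:E]) //;
    exact: measurable_fibers_preimage.
have i2 : P.-integrable setT (EFin \o (fun w => (eps 1%N w)%:R ^+ 2)).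
  apply/integrableP; split; first exact: (mf (fun e => e%:R ^+ 2)).
  rewrite (eq_integral (fun w => ((eps 1%N w)%:R ^+ 2 : R)%:E)).
    by rewrite eps_sqr ltry.
  by move=> w _; rewrite /= ger0_norm // sqr_ge0.
(* A natural number is at most its square, so the second moment controls the first. *)
have i1 : P.-integrable setT (EFin \o (fun w => (eps 1%N w)%:R)).
  apply: (le_integrable measurableT _ _ i2) => [|w _]; first exact: (mf (fun e => e%:R)).
  rewrite /= lee_fin !ger0_norm ?sqr_ge0 //.
  by rewrite -natrX ler_nat; case: (eps 1%N w) => // n; rewrite leq_pmulr.
have i0 : P.-integrable setT (EFin \o (fun w => q0)).
  exact: finite_measure_integrable_cst.
have i1' := integrableZl measurableT q1 i1.
have i2' := integrableZl measurableT q2 i2.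
transitivity (\int[P]_w (((EFin \o (fun=> q0)) \+
   (fun w => q1%:E * ((eps 1%N w)%:R)%:E)) \+
   (fun w => q2%:E * ((eps 1%N w)%:R ^+ 2)%:E)) w)%E.
  by apply: eq_integral => w _; rewrite /= !EFinD !EFinM.
rewrite integralD //; last exact: integrableD.
rewrite integralD // !integralZl // eps_mean eps_sqr.
have -> : (\int[P]_w (EFin \o (fun=> q0)) w = q0%:E)%E.
  by rewrite (integral_cst _ _ q0%:E) // -[RHS]mule1; congr (_ * _)%E; exact: probability_setT.
by rewrite !EFinD !EFinM.
Qed.

(** [xi k j] is 0 or 1 only almost surely: the masses [alpha] and [1 - alpha] add up to 1, so the
    other values form a null event. *)
Lemma measure_bernoulli_le k j A : (0 < k)%N -> (0 < j)%N -> measurable A ->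
  (P A <= P (A `&` xi k j @^-1` [set 1%N]) + P (A `&` xi k j @^-1` [set 0%N]))%E.
Proof.
move=> k0 j0 mA; have [p1 p0] := xi_law k0 j0.
have m1 := @mxi k j 1%N; have m0 := @mxi k j 0%N.
have mU := measurableU _ _ m1 m0.
have PU : P (~` (xi k j @^-1` [set 1%N] `|` xi k j @^-1` [set 0%N])) = 0%E.
  rewrite probability_setC //.
  have -> : P (xi k j @^-1` [set 1%N] `|` xi k j @^-1` [set 0%N]) =
      (P (xi k j @^-1` [set 1%N]) + P (xi k j @^-1` [set 0%N]))%E.
    by apply: measureU => //; rewrite -subset0 => w [/= ->].
  by rewrite p1 p0 -EFinD addrC subrK subrr.
have sub : A `<=` (A `&` xi k j @^-1` [set 1%N] `|` A `&` xi k j @^-1` [set 0%N])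
     `|` ~` (xi k j @^-1` [set 1%N] `|` xi k j @^-1` [set 0%N]).
  move=> w Aw; have [h|h] := pselect ((xi k j @^-1` [set 1%N] `|` xi k j @^-1` [set 0%N]) w).
    by left; case: h => h; [left|right].
  by right.
have mA1 := measurableI _ _ mA m1; have mA0 := measurableI _ _ mA m0.
have mA10 := measurableU _ _ mA1 mA0.
have le1 : (P A <= P ((A `&` xi k j @^-1` [set 1%N]
    `|` A `&` xi k j @^-1` [set 0%N])
     `|` ~` (xi k j @^-1` [set 1%N] `|` xi k j @^-1` [set 0%N])))%E.
  by apply: le_measure; rewrite ?inE //; apply: measurableU => //; exact: measurableC.
have eU : P ((A `&` xi k j @^-1` [set 1%N]
    `|` A `&` xi k j @^-1` [set 0%N])
     `|` ~` (xi k j @^-1` [set 1%N] `|` xi k j @^-1` [set 0%N]))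
  = P (A `&` xi k j @^-1` [set 1%N] `|` A `&` xi k j @^-1` [set 0%N]).
  by apply: measureU0 => //; exact: measurableC.
by move: le1; rewrite eU => /le_trans; apply; exact: measureU2.
Qed.

(** The Bernoulli variables are revealed one at a time, by induction on the number [j] still hidden.
    The factor on the right is the mean of [(c + a * x) ^+ 2 * u + e] for [x] equal to [t] plus a
    binomial variable: squared mean plus variance. [B0] keeps the facts about the past through the
    refinements. *)
Lemma thinning_bound (E B0 : set T) (lam a c u e : R) (k : nat) :
  measurable E -> 0 <= lam -> (0 < k)%N ->
  (forall s B t, cylinder inar_valid X s B ->
    (forall i, i \in s -> (stage i <= k)%N) -> B `<=` B0 ->
    (forall w, B w -> path w k = t) ->
    (lam%:E * P (B `&` E) <= P B * ((c + a * t%:R) ^+ 2 * u + e)%:E)%E) ->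
  forall j s B t, cylinder inar_valid X s B ->
    (forall i, i \in s -> (stage i <= k)%N) -> B `<=` B0 ->
    (forall i, (0 < i <= j)%N -> Ixi k i \notin s) ->
    (forall w, B w -> path w k = (\sum_(1 <= i < j.+1) xi k i w + t)%N) ->
    (lam%:E * P (B `&` E) <= P B *
      (((c + a * (t%:R + j%:R * alpha)) ^+ 2
        + a ^+ 2 * (j%:R * (alpha * (1 - alpha)))) * u + e)%:E)%E.
Proof.
move=> mE lam0 k0 H; elim=> [|j ih] s B t cB sk BB0 fresh Bt.
  rewrite !mul0r !addr0 mulr0 addr0; apply: (H s) => // w Bw.
  by rewrite Bt // big_geq.
have mB : measurable B := measurable_cylinder mX cB.
have vj : inar_valid (Ixi k j.+1) by [].
have js : Ixi k j.+1 \notin s by apply: fresh; rewrite leqnn.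
have [p1 p0] := xi_law k0 (ltn0Sn j).
have PB (b : nat) : (lam%:E * P (B `&` xi k j.+1 @^-1` [set b] `&` E) <=
    P (B `&` xi k j.+1 @^-1` [set b]) *
      (((c + a * ((t + b)%:R + j%:R * alpha)) ^+ 2
        + a ^+ 2 * (j%:R * (alpha * (1 - alpha)))) * u + e)%:E)%E.
  apply: (ih (Ixi k j.+1 :: s)).
  - exact: (cylinder_cons b cB vj js).
  - by move=> i; rewrite inE => /orP[/eqP->//|/sk].
  - by move=> w [/BB0].
  (* The highest index is revealed first, which leaves the lower ones fresh. *)
  - move=> i /andP[i0 ij]; rewrite inE negb_or fresh ?i0 ?(leqW ij) // andbT.
    by apply/eqP => -[eij]; rewrite eij ltnn in ij.
  - move=> w [/Bt -> /= <-].
    by rewrite big_nat_recr //= -addnA (addnC _ t).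
have := PB 1%N; have := PB 0%N.
have ePB b : P (B `&` xi k j.+1 @^-1` [set b]) =
    (P B * P (xi k j.+1 @^-1` [set b]))%E.
  exact: (probability_cylinder_cons indep b cB vj js).
rewrite !ePB p1 p0.
have fB : P B = (fine (P B))%:E by rewrite fineK // fin_num_measure.
have f1 : P (B `&` xi k j.+1 @^-1` [set 1%N] `&` E) \is a fin_num.
  by apply: fin_num_measure; apply: measurableI => //; apply: measurableI => //; exact: mxi.
have f0 : P (B `&` xi k j.+1 @^-1` [set 0%N] `&` E) \is a fin_num.
  by apply: fin_num_measure; apply: measurableI => //; apply: measurableI => //; exact: mxi.
rewrite fB -(fineK f1) -(fineK f0) -!EFinM !lee_fin => h0 h1.
have := measure_bernoulli_le k0 (ltn0Sn j) (measurableI _ _ mB mE).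
rewrite (setIAC B E) (setIAC B E) -(fineK f1) -(fineK f0) -EFinD => hE.
have fBE : P (B `&` E) \is a fin_num.
  by apply: fin_num_measure; apply: measurableI.
move: hE; rewrite -(fineK fBE) lee_fin => hE.
rewrite -EFinM lee_fin; apply: (le_trans (ler_wpM2l lam0 hE)).
rewrite mulrDr; apply: (le_trans (lerD h1 h0)).
(* Equality holds: averaging the square over one Bernoulli variable moves its mean by [a * alpha]
   and adds [a ^+ 2 * (alpha * (1 - alpha))]. *)
rewrite le_eqVlt; apply/orP; left; apply/eqP.
by rewrite addn0 natrD -natr1; ring.
Qed.

(** The supermartingale property in the form of one backward step: the bound at [k.+1] is averaged
    over [eps k.+1] and the thinning variables of stage [k.+1], all fresh for a cylinder of stage at
    most [k], and [lyapunov_budget] concludes. *)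
Lemma innovation_bound (E : set T) (lam : R) (k : nat) :
  measurable E -> 0 <= lam ->
  (forall s B y, cylinder inar_valid X s B ->
    (forall i, i \in s -> (stage i <= k.+1)%N) ->
    (forall w, B w -> forall i, (i <= k.+1)%N -> path w i = y i) ->
    (lam%:E * P (B `&` E) <= P B * (V y k.+1)%:E)%E) ->
  forall s B y, cylinder inar_valid X s B ->
    (forall i, i \in s -> (stage i <= k)%N) ->
    (forall w, B w -> forall i, (i <= k)%N -> path w i = y i) ->
    (lam%:E * P (B `&` E) <= P B * (V y k)%:E)%E.
Proof.
move=> mE lam0 H s B y cB sk By.
have mB : measurable B := measurable_cylinder mX cB.
pose yR i : R := (y i)%:R.
(* The weight of the next residual; it vanishes at outlier times, so the added sizes never reach the
   score ([ath]). *)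
pose a : R := if (k.+1 != s1) && (k.+1 != s2) then yR k else 0.
pose S := score alpha mu s1 s2 yR k.
pose q := root4 s1 s2 yR k.+1; pose p := root4 s1 s2 yR k.
have q0 : 0 < q := root4_gt0 _ _ _ _.
pose u := (q ^+ 7)^-1; pose e0 := 4 * (1 + K) / q.
have u0 : 0 <= u by rewrite invr_ge0 exprn_ge0 // ltW.
have e00 : 0 <= e0 by rewrite divr_ge0 ?(ltW q0) // mulr_ge0 ?addr_ge0.
(* Chosen so that the next score is [c + a * t] when the next value is [t]. *)
pose c := S - a * (alpha * yR k + mu).
pose th := ((k.+1 == s1) * th1 + (k.+1 == s2) * th2)%N.
have ath : a * th%:R = 0.
  rewrite /a /th; case: eqVneq => //= _; rewrite ?mul0r //.
  by case: eqVneq => //= _; rewrite ?mul0r // mulr0.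
pose r := a ^+ 2 * (yR k * (alpha * (1 - alpha))).
have r0 : 0 <= r.
  case/andP: alpha01 => ? ?.
  by rewrite mulr_ge0 ?sqr_ge0 // mulr_ge0 // mulr_ge0 ?subr_ge0 ?ltW.
pose G (e : nat) := ((c + a * ((e + th)%:R + yR k * alpha)) ^+ 2 + r) * u + e0.
have G0 e : 0 <= G e by rewrite addr_ge0 // mulr_ge0 // addr_ge0 // sqr_ge0.
have Hthin s' B' t : cylinder inar_valid X s' B' ->
    (forall i, i \in s' -> (stage i <= k.+1)%N) -> B' `<=` B ->
    (forall w, B' w -> path w k.+1 = t) ->
    (lam%:E * P (B' `&` E) <= P B' * ((c + a * t%:R) ^+ 2 * u + e0)%:E)%E.
  move=> cB' sk' BB' Bt.
  pose y' i := if i == k.+1 then t else y i.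
  have yy' i : (i <= k)%N -> (y' i)%:R = yR i :> R.
    by move=> ik; rewrite /y' ltn_eqF.
  have -> : (c + a * t%:R) ^+ 2 * u + e0 = V y' k.+1.
    rewrite /V /lyapunov scoreS (score_eq _ _ _ _ yy') yy' //.
    have -> : root4 s1 s2 (fun i => (y' i)%:R) k.+1 = q.
      rewrite /q /root4; congr (Num.sqrt (Num.sqrt (1 + _))).
      exact: design_eq.
    rewrite /y' eqxx -/a -/S -/e0 -/u; congr (_ ^+ 2 * u + e0); rewrite /c; ring.
  apply: (H s') => // w B'w i; rewrite leq_eqVlt => /orP[/eqP->|ik].
    by rewrite /y' eqxx Bt.
  by rewrite /y' ltn_eqF // (By _ (BB' _ B'w)).
have fresh : Ieps k.+1 \notin s by apply/negP => /sk; rewrite /= ltnn.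
have ve : inar_valid (Ieps k.+1) by [].
have step e : (lam%:E * P (B `&` eps k.+1 @^-1` [set e] `&` E)
    <= P B * P (eps 1%N @^-1` [set e]) * (G e)%:E)%E.
  have -> : (P B * P (eps 1%N @^-1` [set e]) = P (B `&` eps k.+1 @^-1` [set e]))%E.
    by rewrite -(eps_id e (ltn0Sn k));
      rewrite -(probability_cylinder_cons indep e cB ve fresh).
  apply: (thinning_bound mE lam0 (ltn0Sn k) Hthin
    (cylinder_cons e cB ve fresh) (t := (e + th)%N)).
  - by move=> i; rewrite inE => /orP[/eqP->//|/sk h]; exact: leqW.
  - by move=> w [].
  - by move=> i _; rewrite inE negb_or; apply/andP; split; [exact/eqP|apply/negP => /sk; rewrite /= ltnn].
  - by move=> w [Bw /= <-]; rewrite /path /= -/(path w k) (By _ Bw) // /th !addnA.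
have fB : P B = (fine (P B))%:E by rewrite fineK // fin_num_measure.
have intG : (\int[P]_w (G (eps 1%N w))%:E =
    ((S ^+ 2 + (a ^+ 2 * (K - mu ^+ 2) + r)) * u + e0)%:E)%E.
  pose c0 := c + a * (th%:R + yR k * alpha).
  (* Adding [a] times an innovation of mean [mu] brings the mean back to [S], so only [S ^+ 2] and
     variance terms remain. *)
  have c0E : c0 = S - a * mu by rewrite /c0 mulrDr ath /c; ring.
  rewrite (_ : (fun w => (G (eps 1%N w))%:E) = fun w =>
    (((c0 ^+ 2 + r) * u + e0) + 2 * c0 * a * u * (eps 1%N w)%:R
     + a ^+ 2 * u * (eps 1%N w)%:R ^+ 2)%:E).
    by rewrite integral_quadratic; congr (_%:E); rewrite c0E; ring.
  by apply: funext => w; congr (_%:E); rewrite /G natrD /c0; ring.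
rewrite (measure_fibers P (@meps k.+1) (measurableI _ _ mB mE)) -nneseriesZl //.
apply: (@le_trans _ _
  (\sum_(0 <= e <oo) (fine (P B))%:E * ((G e)%:E * P (eps 1%N @^-1` [set e])))%E).
  apply: lee_nneseries => [e _ _|e _]; first by rewrite mule_ge0.
  by rewrite setIAC (le_trans (step e)) // fB -muleA (muleC (P _)).
rewrite nneseriesZl; last by move=> e _; rewrite mule_ge0 // lee_fin.
rewrite -integral_fibers // intG -fB lee_wpmul2l // lee_fin.
rewrite (_ : V y k = S ^+ 2 / p ^+ 7 + 4 * (1 + K) / p) //.
apply: (@lyapunov_budget _ p q S _ a) => //; rewrite ?root4_ge1 ?addr_ge0 //.
  by rewrite !root4X4 designS addrA.
have [a0|aE] : a = 0 \/ a = yR k by rewrite /a; case: ifP; [right|left].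
  by rewrite /r a0 expr0n /= !(mul0r, mulr0) addr0.
have q1 : 1 <= q ^+ 2 by rewrite expr_ge1 ?root4_ge1 // ltW.
(* Self-normalization: [q ^+ 4] already contains the summand [yR k ^+ 2]. *)
have yq : yR k <= q ^+ 2.
  rewrite -(@ler_pXn2r _ 2) ?nnegrE ?ler0n ?sqr_ge0 // root4_sqr2 designS -/a aE.
  by rewrite addrA lerDr addr_ge0 // design_ge0.
have al : alpha * (1 - alpha) <= 1 by case/andP: alpha01 => ? ?; nra.
have yal : yR k * (alpha * (1 - alpha)) <= q ^+ 2.
  by rewrite (le_trans _ yq) // ler_piMr // ler0n.
rewrite /r -mulrDr -[leRHS]mulrA [leRHS]mulrCA ler_wpM2l ?sqr_ge0 //.
have Kq : K <= K * q ^+ 2 by rewrite ler_peMr.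
have mu2 := sqr_ge0 mu.
by rewrite mulrDl mul1r; lra.
Qed.

(** * The maximal inequality and almost sure boundedness *)

(** If [V] has reached [lam] at time [k], the bound is immediate from [lam <= V y k]. Otherwise a
    crossing can only occur from [k.+1] on, within a shorter horizon, and [innovation_bound] carries
    the bound back to [k]. *)
Lemma cylinder_hit_bound (lam : R) : 0 <= lam ->
  forall N k s B y, cylinder inar_valid X s B ->
    (forall i, i \in s -> (stage i <= k)%N) ->
    (forall w, B w -> forall i, (i <= k)%N -> path w i = y i) ->
    (lam%:E * P (B `&` hit lam k N) <= P B * (V y k)%:E)%E.
Proof.
move=> lam0; elim=> [|N ih] k s B y cB sk By;
  have mB : measurable B := measurable_cylinder mX cB;
  have VE w : B w -> V (path w) k = V y k
    by [move=> Bw; apply: lyapunov_eq => i ik; rewrite (By _ Bw)];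
  (have [lamV|Vlam] := leP lam (V y k);
    first by apply: (@le_trans _ _ (lam%:E * P B)%E);
      [ rewrite lee_wpmul2l // ?lee_fin //; apply: le_measure; rewrite ?inE //;
        apply: measurableI => //; exact: measurable_hit
      | by rewrite muleC lee_wpmul2l // lee_fin]).
  rewrite (_ : B `&` _ = set0) ?measure0 ?mule0.
    by rewrite mule_ge0 // lee_fin lyapunov_ge0 // addr_ge0.
  rewrite -subset0 => w [Bw [i]]; rewrite leqn0 => /eqP->.
  by rewrite addn0 VE // leNgt Vlam.
rewrite (_ : B `&` _ = B `&` hit lam k.+1 N).
  apply: (innovation_bound (measurable_hit lam k.+1 N) lam0 _ cB sk By).
  by move=> s' B' y' cB' sk' By'; exact: (ih _ s').
rewrite predeqE => w; split=> -[Bw [i iN lamV]]; split=> //.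
  case: i iN lamV => [|i] iN lamV; last by exists i; rewrite // addSnnS.
  by move: lamV; rewrite addn0 VE // leNgt Vlam.
by exists i.+1; rewrite // -addSnnS.
Qed.

(** Each value of [Y0] gives a cylinder of stage 0, and [V] starts from the same constant on all of
    them. *)
Lemma hit_bound (lam : R) N : 0 <= lam ->
  (lam%:E * P (hit lam 0 N) <= (4 * (1 + K))%:E)%E.
Proof.
move=> lam0.
rewrite (measure_fibers P mY0 (measurable_hit lam 0 N)) -nneseriesZl //.
apply: (@le_trans _ _
  (\sum_(0 <= e <oo) (4 * (1 + K))%:E * P (Y0 @^-1` [set e]))%E).
  apply: lee_nneseries => [e _ _|e _]; first by rewrite mule_ge0.
  rewrite setIC muleC [leRHS]muleC.
  have cB : cylinder inar_valid X [:: IY0] (setT `&` X IY0 @^-1` [set e]).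
    exact: cylinder_cons (cylinder_nil _ _) _ _.
  have := @cylinder_hit_bound lam lam0 N 0%N [:: IY0] _ (fun=> e) cB.
  rewrite setTI /V lyapunov0 muleC; apply.
    by move=> i; rewrite inE => /eqP->.
  by move=> w /= <- i; rewrite leqn0 => /eqP->.
rewrite nneseriesZl // -[leRHS]mule1 lee_wpmul2l ?lee_fin ?mulr_ge0 ?addr_ge0 //.
rewrite -(probability_setT P) (measure_fibers P mY0 measurableT).
by apply: lee_nneseries => [e _ _|e _]; rewrite ?setTI // measure_ge0.
Qed.

(** Level [m.+1] is ever reached with probability at most [4 * (1 + K) / m.+1], so reaching every
    level is a null event. *)
Lemma lyapunov_bounded_ae :
  {ae P, forall w, exists lam, forall n, V (path w) n < lam}.
Proof.
pose H m := \bigcup_N hit m.+1%:R 0 N.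
have mH m : measurable (H m).
  by apply: bigcup_measurable => N _; exact: measurable_hit.
have PH m : (m.+1%:R%:E * P (H m) <= (4 * (1 + K))%:E)%E.
  have ndec : {homo hit m.+1%:R 0 : N N' / (N <= N')%N >-> (N <= N')%O}.
    move=> N N' NN'; apply/subsetPset => w [i iN h].
    by exists i => //; exact: leq_trans NN'.
  have mh N := measurable_hit m.+1%:R 0 N.
  (* Continuity from below: the bound on [hit] is uniform in the horizon. *)
  have cv := nondecreasing_cvg_mu (mu := P) mh (mH m) ndec.
  rewrite muleC -lee_pdivlMr // -(cvg_lim _ cv) //.
  apply: lime_le; first by apply/cvg_ex; eexists; exact: cv.
  by apply: nearW => N; rewrite /= lee_pdivlMr // muleC hit_bound.
have mI : measurable (\bigcap_m H m) by apply: bigcapT_measurable.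
exists (\bigcap_m H m); split => //.
  have fI : P (\bigcap_m H m) \is a fin_num by exact: fin_num_measure.
  have le m : m.+1%:R * fine (P (\bigcap_m H m)) <= 4 * (1 + K).
    rewrite -lee_fin EFinM fineK // (le_trans _ (PH m)) // lee_wpmul2l // ?lee_fin //.
    by apply: le_measure; rewrite ?inE //; exact: bigcap_inf.
  have p0 : 0 <= fine (P (\bigcap_m H m)) by rewrite fine_ge0.
  rewrite -(fineK fI); congr (_%:E); apply/eqP; rewrite eq_le p0 andbT leNgt.
  apply/negP => pgt0.
  have := le (Num.trunc (4 * (1 + K) / fine (P (\bigcap_m H m)))).
  by rewrite -ler_pdivlMr // leNgt truncnS_gt.
move=> w /= nb m _; apply: contrapT => nH; apply: nb; exists m.+1%:R => n.
rewrite ltNge; apply/negP => h; apply: nH; exists n => //.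
by exists n.
Qed.

(** A run of [n] zeros has probability [p ^+ n] with [p < 1], so an endless run is null from each of
    the countably many starting times. *)
Lemma eps_infinitely_often : (0 < P [set w | eps 1%N w != 0%N])%E ->
  {ae P, forall w, forall m, exists2 k, (m <= k)%N & eps k w != 0%N}.
Proof.
move=> eps0.
pose Z m := [set w | forall k, (m <= k)%N -> eps k w = 0%N].
have mZ m : measurable (Z m).
  rewrite (_ : Z m = \bigcap_(k in [set k | (m <= k)%N]) eps k @^-1` [set 0%N]) //.
  by apply: bigcap_measurable => [|k _]; [exists m => /=|exact: meps].
pose p := fine (P (eps 1%N @^-1` [set 0%N])).
have pE : P (eps 1%N @^-1` [set 0%N]) = p%:E by rewrite fineK // fin_num_measure //; exact: meps.
have p0 : 0 <= p by rewrite fine_ge0.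
have p1 : p < 1.
  have : P (~` (eps 1%N @^-1` [set 0%N])) = (1 - p%:E)%E.
    by rewrite -pE; apply: probability_setC; exact: meps.
  rewrite (_ : ~` _ = [set w | eps 1%N w != 0%N]).
    by move=> h; move: eps0; rewrite h -EFinB lte_fin subr_gt0.
  by rewrite predeqE => w; split => [/= /eqP|/= /eqP].
have Zn m n : (P (Z m) <= (p ^+ n)%:E)%E.
  (* Starting at [m.+1] keeps every index positive, as [inar_valid] asks, also for [m = 0]. *)
  pose s := [seq Ieps k | k <- iota m.+1 n].
  have us : uniq s by rewrite map_inj_uniq ?iota_uniq // => i j [].
  have vs i : i \in s -> inar_valid i.
    by case/mapP => k; rewrite mem_iota => /andP[mk _] -> /=; exact: leq_ltn_trans mk.
  have := probability_cylinder indep (fun=> 0%N) us vs.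
  rewrite big_map -/X (eq_big_seq (fun=> p%:E)); last first.
    move=> k; rewrite mem_iota => /andP[mk _].
    by rewrite [X _]/= eps_id ?pE //; exact: leq_ltn_trans mk.
  rewrite big_const_seq count_predT size_iota.
  have -> : iter n (mule p%:E) 1%E = (p ^+ n)%:E.
    by elim: n {s us vs} => //= n ->; rewrite exprS.
  move=> <-; apply: le_measure; rewrite ?inE //.
    apply: (measurable_cylinder (D := inar_valid) mX (s := s)).
    by split => //; exists (fun=> 0%N).
  move=> w Zw i /mapP[k]; rewrite mem_iota => /andP[mk _] ->.
  by apply: Zw; exact: ltnW.
have PZ m : P (Z m) = 0%E.
  have fZ : P (Z m) \is a fin_num by exact: fin_num_measure.
  have f0 : 0 <= fine (P (Z m)) by rewrite fine_ge0.
  rewrite -(fineK fZ); congr (_%:E); apply/eqP; rewrite eq_le f0 andbT leNgt.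
  apply/negP => fgt0.
  have /cvgrPdist_lt/(_ _ fgt0)[n _ /(_ n (leqnn n))] : (p ^+ n @[n --> \oo] --> (0 : R)).
    by apply: cvg_expr; rewrite ger0_norm.
  rewrite /= sub0r normrN ger0_norm ?exprn_ge0 // ltNge -lee_fin fineK //.
  by rewrite Zn.
exists (\bigcup_m Z m); split.
- exact: bigcupT_measurable.
- apply/(negligibleP P (bigcupT_measurable Z mZ))/negligible_bigcup => m.
  by apply/(negligibleP P (mZ m)); exact: PZ.
- move=> w /= /existsNP[m h]; exists m => // k mk; apply: contrapT => /eqP ek.
  by apply: h; exists k.
Qed.

End Model.

(** * Unique minimizer and strong consistency *)

Theorem theorem4p4p1 (R : realType) (d : measure_display) (T : measurableType d)
  (P : probability T R) (alpha : R) (mu : R)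
  (eps : nat -> T -> nat) (xi : nat -> nat -> T -> nat) (Y0 : T -> nat)
  (s1 s2 th1 th2 : nat) :
  0 < alpha < 1 ->
  (forall k, measurable_fun setT (eps k)) ->
  (forall k j, measurable_fun setT (xi k j)) ->
  measurable_fun setT Y0 ->
  mutually_independent P inar_valid
    (fun i => match i with
              | IY0 => Y0
              | Ieps k => eps k
              | Ixi k j => xi k j
              end) ->
  (forall k m, (0 < k)%N -> P (eps k @^-1` [set m]) = P (eps 1%N @^-1` [set m])) ->
  (\int[P]_w (((eps 1%N w)%:R : R) ^+ 2)%:E < +oo)%E ->
  (0 < P [set w | eps 1%N w != 0%N])%E ->
  (\int[P]_w ((eps 1%N w)%:R : R)%:E = mu%:E)%E ->
  (forall k j, (0 < k)%N -> (0 < j)%N ->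
     P (xi k j @^-1` [set 1%N]) = alpha%:E /\
     P (xi k j @^-1` [set 0%N]) = (1 - alpha)%:E) ->
  (\int[P]_w (((Y0 w)%:R : R) ^+ 2)%:E < +oo)%E ->
  (0 < s1)%N -> (0 < s2)%N -> s1 != s2 -> (0 < th1)%N -> (0 < th2)%N ->
  let Y : T -> nat -> R := fun w k =>
    ((inar_Y (fun k j => xi k j w) (fun k => eps k w) (Y0 w) s1 s2 th1 th2 k)%:R : R) in
  {ae P, forall w, exists n0 : nat, forall n : nat, (n0 <= n)%N ->
     forall a t1 t2 : R,
       (a, t1, t2) <> (alpha_tilde mu s1 s2 (Y w) n,
                       theta_tilde mu s1 s2 (Y w) n s1,
                       theta_tilde mu s1 s2 (Y w) n s2) ->
       Qn mu s1 s2 (Y w) n (alpha_tilde mu s1 s2 (Y w) n)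
          (theta_tilde mu s1 s2 (Y w) n s1) (theta_tilde mu s1 s2 (Y w) n s2)
       < Qn mu s1 s2 (Y w) n a t1 t2}
  /\ {ae P, forall w, (fun n : nat => alpha_tilde mu s1 s2 (Y w) n) @ \oo --> (alpha : R)}
  /\ {ae P, forall w, (fun n : nat => theta_tilde mu s1 s2 (Y w) n s1) @ \oo
                      --> (Y w s1 - alpha * Y w s1.-1 - mu)}
  /\ {ae P, forall w, (fun n : nat => theta_tilde mu s1 s2 (Y w) n s2) @ \oo
                      --> (Y w s2 - alpha * Y w s2.-1 - mu)}.
Proof.
move=> alpha01 meps mxi mY0 indep eps_id eps_sq_fin eps0 eps_mean xi_law _ _ _ _ _ _ Y.
have fibers (Z : T -> nat) : measurable_fun setT Z -> measurable_fibers Z.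
  by move=> mZ c; rewrite -[X in measurable X]setTI; exact: mZ.
have epsF k := fibers _ (meps k).
have xiF k j := fibers _ (mxi k j).
have Y0F := fibers _ mY0.
pose K := fine (\int[P]_w (((eps 1%N w)%:R : R) ^+ 2)%:E)%E.
have eps_sq : (\int[P]_w (((eps 1%N w)%:R : R) ^+ 2)%:E = K%:E)%E.
  rewrite /K fineK // ge0_fin_numE //.
  by apply: integral_ge0 => w _; rewrite lee_fin sqr_ge0.
have K0 : 0 <= K by rewrite fine_ge0 // integral_ge0 // => w _; rewrite lee_fin sqr_ge0.
have Dinf : {ae P, forall w, forall M : R, exists n0, forall n, (n0 <= n)%N ->
    M <= design s1 s2 (Y w) n}.
  apply: filterS (eps_infinitely_often epsF xiF Y0F indep eps_id eps0) => w epsio.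
  (* The shift to [m.+1] makes [k] positive: only then is [eps k] a summand of [Y w k], and a
     nonzero one forces [Y w k >= 1]. *)
  apply: design_unbounded => m; have [k mk ek] := epsio m.+1.
  exists k; first exact: ltnW.
  case: k mk ek => // k _ ek.
  rewrite /Y ler1n /= -!addnA addnCA; apply: leq_trans (leq_addr _ _).
  by rewrite lt0n.
have Vbd := lyapunov_bounded_ae s1 s2 th1 th2 alpha01 epsF xiF Y0F indep eps_id
  eps_mean eps_sq xi_law.
have acvg : {ae P, forall w, alpha_tilde mu s1 s2 (Y w) n @[n --> \oo] --> alpha}.
  apply: filterS2 Dinf Vbd => w Dw [lam Vw].
  by apply: alpha_tilde_cvg Dw Vw; rewrite addr_ge0.
have tcvg s : {ae P, forall w, theta_tilde mu s1 s2 (Y w) n s @[n --> \oo] -->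
    Y w s - alpha * Y w s.-1 - mu}.
  apply: filterS acvg => w aw; apply: cvgB; last exact: cvg_cst.
  by apply: cvgB; [exact: cvg_cst|apply: cvgMl].
split; last by [].
(* From [n0] on the design is at least 1, so the criterion is strictly convex. *)
apply: filterS Dinf => w Dw; have [n0 hn0] := Dw 1; exists n0 => n nn a t1 t2 neq.
by apply: Qn_unique_min => //; exact: lt_le_trans ltr01 (hn0 _ nn).
Qed.
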